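(* Let $S\subseteq[N]$. The inequalities $$z_s\ \ge\ \sum_{\tilde s\in\mathbf{V}(S)}z_{\tilde s}-|\mathbf{V}(S)|+1\qquad\forall s\in\mathbf{N}(S)\setminus\mathbf{V}(S)$$ are valid for (MI-CCP), i.e. including them in (MI-CCP) does not increase its optimal value $F^*_\tau$. If moreover the scenarios are equally likely ($\pi^{(s)}=1/N$ for all $s\in[N]$) and $\sum_{s\in\mathbf{N}(S)}\pi^{(s)}\ge(1-\tau)+N^{-1}$, then the inequality $$\sum_{\tilde s\in\mathbf{V}(S)}z_{\tilde s}\ \le\ |\mathbf{V}(S)|-1$$ is valid for (MI-CCP), i.e. including it in (MI-CCP) does not increase its optimal value $F^*_\tau$.
   Context: Setting. $\xi$ is a random vector in $\mathbb{R}^p$ with finite support $\{\xi^{(1)},\dots,\xi^{(N)}\}$ of cardinality $N$ (so the scenarios $\xi^{(s)}$ are pairwise distinct), $[N]=\{1,\dots,N\}$, and $\pi^{(s)}=\mathbb{P}[\xi=\xi^{(s)}]$, with $\sum_{s}\pi^{(s)}=1$. Let $\mathcal{X}\subseteq\mathbb{R}^d$, $F:\mathbb{R}^d\to\mathbb{R}$, $c:\mathbb{R}^d\times\mathbb{R}^p\to\mathbb{R}$, $\tau\in(0,1)$, and let $M^{(s)}\in\mathbb{R}$ satisfy $M^{(s)}\ge\max_{x\in\mathcal{X}}c(x,\xi^{(s)})$ for each $s\in[N]$. For $S\subseteq[N]$ define $\nu(S)$ as the optimal value of $\min_{x\in\mathcal{X}}F(x)$ subject to $c(x,\xi^{(s)})\le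 0$ for all $s\in S$. Infeasible minimization problems have value $+\infty$, unbounded ones $-\infty$. Standing assumptions. (A) For every $s\in[N]$, $\pi^{(s)}>0$ and $\nu(\{s\})>-\infty$. (B) For every $x\in\mathcal{X}$, the function $c(x,\cdot)$ is quasi-convex on $\mathbb{R}^p$. Problem (MI-CCP), with optimal value $F^*_\tau$: minimize $F(x)$ over $x\in\mathcal{X}$, $z\in\{0,1\}^N$ subject to $\sum_{s=1}^N\pi^{(s)}z_s\ge 1-\tau$ and $c(x,\xi^{(s)})\le M^{(s)}(1-z_s)$ for all $s\in[N]$. For $S\subseteq[N]$ let $\Xi=\mathrm{conv}(\{\xi^{(\tilde s)} : \tilde s\in S\})$. Then $\mathbf{V}(S)=\{s\in S : \xi^{(s)}\text{ is a vertex (extreme point) of }\Xi\}$ and $\mathbf{N}(S)=\{s\in[N] : \xi^{(s)}\in\Xi\}$. *)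

(* Defs.v *)
From HB Require Import structures.
From mathcomp Require Import all_boot all_order all_algebra.
From mathcomp Require Import all_classical all_reals all_analysis.

Set Implicit Arguments.
Unset Strict Implicit.
Unset Printing Implicit Defensive.

Import Order.TTheory GRing.Theory Num.Theory.
Import numFieldNormedType.Exports.

Local Open Scope classical_set_scope.
Local Open Scope ring_scope.
Local Open Scope convex_scope.

(* The parameter [t] of [a <| t |> b] ranges over the closed interval [0, 1]. *)
Definition quasiconvex (R : realType) (E : lmodType R)
    (f : convex_lmodType E -> R) : Prop :=
  forall (a b : convex_lmodType E) (t : {i01 R}),
    f (a <| t |> b) <= Num.max (f a) (f b).

Definition convex_hull (R : realType) (E : lmodType R) (A : set E) : set E :=
  smallest (@convex_set R E) A.

Definition extreme_point (R : realType) (E : lmodType R) (A : set E) (v : E) :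
    Prop :=
  A v /\ forall (a b : convex_lmodType E) (t : {i01 R}),
    A a -> A b -> 0 < t%:num -> t%:num < 1 -> v = a <| t |> b ->
    a = v /\ b = v.

(* [+oo] when [A] is empty, [-oo] when [F] is unbounded below on [A]. *)
Definition min_value (R : realType) (T : Type) (A : set T) (F : T -> R) :
    \bar R :=
  ereal_inf [set (F x)%:E | x in A].

Definition nu (R : realType) (d p N : nat) (X : set 'rV[R]_d)
    (F : 'rV[R]_d -> R) (c : 'rV[R]_d -> 'rV[R]_p -> R)
    (scen : 'I_N -> 'rV[R]_p) (S : {set 'I_N}) : \bar R :=
  min_value [set x | X x /\ forall s, s \in S -> c x (scen s) <= 0] F.

Definition scenario_hull (R : realType) (p N : nat) (scen : 'I_N -> 'rV[R]_p)
    (S : {set 'I_N}) : set 'rV[R]_p :=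
  convex_hull [set scen s | s in [set` S]].

Definition vertex_scenarios (R : realType) (p N : nat)
    (scen : 'I_N -> 'rV[R]_p) (S : {set 'I_N}) : {set 'I_N} :=
  [set s in S | `[< extreme_point (scenario_hull scen S) (scen s) >]]%SET.

Definition hull_scenarios (R : realType) (p N : nat)
    (scen : 'I_N -> 'rV[R]_p) (S : {set 'I_N}) : {set 'I_N} :=
  [set s : 'I_N | `[< scenario_hull scen S (scen s) >]]%SET.

(* Binary vectors are boolean functions, [(z s)%:R] being 0 or 1 in [R]. *)
Definition miccp_feasible (R : realType) (d p N : nat) (X : set 'rV[R]_d)
    (c : 'rV[R]_d -> 'rV[R]_p -> R) (scen : 'I_N -> 'rV[R]_p)
    (prob : 'I_N -> R) (tau : R) (M : 'I_N -> R) :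
    set ('rV[R]_d * {ffun 'I_N -> bool}) :=
  [set xz : 'rV[R]_d * {ffun 'I_N -> bool} | [/\ X xz.1,
    1 - tau <= \sum_(s < N) prob s * (xz.2 s)%:R &
    forall s, c xz.1 (scen s) <= M s * (1 - (xz.2 s)%:R)]].

Definition miccp_value (R : realType) (d p N : nat) (X : set 'rV[R]_d)
    (F : 'rV[R]_d -> R) (c : 'rV[R]_d -> 'rV[R]_p -> R)
    (scen : 'I_N -> 'rV[R]_p) (prob : 'I_N -> R) (tau : R) (M : 'I_N -> R) :
    \bar R :=
  min_value (miccp_feasible X c scen prob tau M) (fun xz => F xz.1).

Definition miccp_value_with (R : realType) (d p N : nat) (X : set 'rV[R]_d)
    (F : 'rV[R]_d -> R) (c : 'rV[R]_d -> 'rV[R]_p -> R)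
    (scen : 'I_N -> 'rV[R]_p) (prob : 'I_N -> R) (tau : R) (M : 'I_N -> R)
    (Q : {ffun 'I_N -> bool} -> Prop) : \bar R :=
  min_value (miccp_feasible X c scen prob tau M `&` [set xz | Q xz.2])
    (fun xz => F xz.1).

(* Validity is about the optimal value only: a valid constraint on [z] may cut
   off feasible points [(x, z)]. *)
Definition miccp_valid (R : realType) (d p N : nat) (X : set 'rV[R]_d)
    (F : 'rV[R]_d -> R) (c : 'rV[R]_d -> 'rV[R]_p -> R)
    (scen : 'I_N -> 'rV[R]_p) (prob : 'I_N -> R) (tau : R) (M : 'I_N -> R)
    (Q : {ffun 'I_N -> bool} -> Prop) : Prop :=
  (miccp_value_with X F c scen prob tau M Q
    <= miccp_value X F c scen prob tau M)%E.

(* Main.v *)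
Require Import Defs.
From mathcomp Require Import all_boot all_order all_algebra.
From mathcomp Require Import all_classical all_reals all_analysis.
From mathcomp Require Import lra.
Import Order.TTheory GRing.Theory Num.Theory.
Import numFieldNormedType.Exports.
Local Open Scope classical_set_scope.
Local Open Scope ring_scope.

(** Everything rests on one geometric fact and one exchange of [z].

    The geometric fact is the finite-dimensional, finitely generated case of
    the Krein-Milman theorem: the hull of the scenarios in [S] is already the
    hull of its vertices ([scenario_hull_vertices]). A scenario that is not
    extreme is a convex combination of the other scenarios
    ([non_extreme_in_hull]), so it can be deleted without changing the hull,
    hence without changing which scenarios are vertices; deleting repeatedly
    leaves exactly the vertices. Since the sublevel sets of the quasi-convex
    function [c x] are convex, a point [x] that satisfies the scenarios of
    [V(S)] satisfies all those of [N(S)] ([quasiconvex_hull_scenarios]).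

    The exchange: the objective ignores [z], so in a feasible pair [(x, z)] one
    may replace [z] by any other feasible choice. The largest one,
    [satisfied c scen x], selects every scenario that [x] satisfies. If it misses
    a vertex, the lower bound on [z s] is at most 0 and the bound on the sum over
    [V(S)] holds outright. Otherwise it is 1 on the whole of [N(S)], which
    gives the first inequalities; and for the second one, deselecting a single
    vertex costs probability [1/N], which the assumed probability of [N(S)]
    leaves to spare. *)

(** * Convex combinations of a finite family *)

Definition convex_weights {R : realType} {I : finType} (S : {set I})
    (w : I -> R) : Prop :=
  (forall i, 0 <= w i) /\ \sum_(i in S) w i = 1.

Definition convex_combination {R : realType} {E : lmodType R} {I : finType}
    (x : I -> E) (S : {set I}) (v : E) : Prop :=
  exists2 w : I -> R, convex_weights S w & v = \sum_(i in S) w i *: x i.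

Lemma convex_weight_le1 {R : realType} {I : finType} {S : {set I}}
    {w : I -> R} {i : I} :
  i \in S -> convex_weights S w -> w i <= 1.
Proof. by move=> iS [w0 <-]; rewrite (big_setD1 i iS)/= lerDl sumr_ge0. Qed.

Lemma convex_weights_mix {R : realType} {I : finType} {S : {set I}}
    {wa wb : I -> R} (t : {i01 R}) :
  convex_weights S wa -> convex_weights S wb ->
  convex_weights S (fun i => t%:num * wa i + (1 - t%:num) * wb i).
Proof.
move=> [wa0 wa1] [wb0 wb1]; split=> [i|].
  by rewrite addr_ge0// mulr_ge0// subr_ge0.
by rewrite big_split/= -!mulr_sumr wa1 wb1 !mulr1 subrKC.
Qed.

Lemma sum_weights_mix {R : realType} {E : lmodType R} {I : finType}
    (x : I -> E) (S : {set I}) (wa wb : I -> R) (t : R) :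
  t *: (\sum_(i in S) wa i *: x i) + (1 - t) *: (\sum_(i in S) wb i *: x i) =
  \sum_(i in S) (t * wa i + (1 - t) * wb i) *: x i.
Proof.
rewrite !scaler_sumr -big_split/=; apply: eq_bigr => i _.
by rewrite !scalerA -scalerDl.
Qed.

Lemma convex_combination_point {R : realType} {E : lmodType R} {I : finType}
    (x : I -> E) {S : {set I}} {i : I} :
  i \in S -> convex_combination x S (x i).
Proof.
move=> iS; exists (fun j => (j == i)%:R); first split=> [j|].
- exact: ler0n.
- by rewrite (bigD1 i) //= eqxx big1 ?addr0// => j /andP[_ /negbTE->].
- rewrite (bigD1 i) //= eqxx scale1r big1 ?addr0// => j /andP[_ /negbTE->].
  by rewrite scale0r.
Qed.

(** Nonnegativity leaves no weight for the other points. *)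
Lemma sum_weight1 {R : realType} {E : lmodType R} {I : finType}
    (x : I -> E) {S : {set I}} {w : I -> R} {i : I} :
  i \in S -> convex_weights S w -> w i = 1 ->
  \sum_(j in S) w j *: x j = x i.
Proof.
move=> iS [w0 w1] wi1.
have /eqP : \sum_(j in S | j != i) w j = 0.
  by move: w1; rewrite (bigD1 i) //= wi1 => /(canRL (addKr _)); rewrite addNr.
rewrite psumr_eq0 => [/allP wj0|//].
rewrite (bigD1 i) //= wi1 scale1r big1 ?addr0// => j jSi.
by have /implyP/(_ jSi)/eqP-> := wj0 j (mem_index_enum _); rewrite scale0r.
Qed.

(** Rescaling the weights other than [w i] by [1 - w i] isolates one point of
    the family; this is the inductive step for convex sets, and it is how a
    point that is a combination involving itself gets eliminated. *)
Lemma sum_weights_split {R : realType} {E : lmodType R} {I : finType}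
    (x : I -> E) {S : {set I}} {w : I -> R} {i : I} :
  i \in S -> convex_weights S w -> w i < 1 ->
  exists2 y, convex_combination x (S :\ i) y &
    \sum_(j in S) w j *: x j = w i *: x i + (1 - w i) *: y.
Proof.
move=> iS [w0 w1] wi1; have u_neq0 : 1 - w i != 0 by rewrite subr_eq0 gt_eqF.
have uE : \sum_(j in S :\ i) w j = 1 - w i.
  by rewrite -w1 (big_setD1 i iS)/= [RHS]addrC addKr.
exists (\sum_(j in S :\ i) (w j / (1 - w i)) *: x j).
  exists (fun j => w j / (1 - w i)) => //; split=> [j|].
    by rewrite divr_ge0// subr_ge0 ltW.
  by rewrite -mulr_suml uE mulfV.
rewrite (big_setD1 i iS)/=; congr (_ + _); rewrite scaler_sumr.
by apply: eq_bigr => j _; rewrite scalerA mulrC divfK.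
Qed.

Lemma convex_set_combination {R : realType} {E : lmodType R} {I : finType}
    (x : I -> E) (C : set E) (S : {set I}) (v : E) :
  @convex_set R E C -> (forall i, i \in S -> C (x i)) ->
  convex_combination x S v -> C v.
Proof.
move=> cC; have [n] := ubnP #|S|; elim: n => // n IHn in S v *.
rewrite ltnS => Sn xC [w ww ->].
have [S0|[i iS]] := set_0Vmem S.
  by case: ww => _; rewrite S0 big_set0 => /esym/eqP; rewrite oner_eq0.
have wi_le1 := convex_weight_le1 iS ww.
have [wi1|wi1] := eqVneq (w i) 1.
  by rewrite (sum_weight1 x iS ww wi1); exact: xC.
have wi_lt1 : w i < 1 by rewrite lt_neqAle wi1.
have [y xy ->] := sum_weights_split x iS ww wi_lt1.
have yC : C y.
  apply: IHn xy => [|j /setD1P[_]]; last exact: xC.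
  by apply: leq_trans Sn; rewrite (cardsD1 i S) iS.
have := cC (x i) y (Itv01 (ww.1 i) wi_le1).
by rewrite !inE; apply => //; exact: xC.
Qed.

(** Weights describe the hull from inside, which makes the definition of the
    hull as a smallest convex set usable for extremality arguments. *)
Lemma convex_hull_imageP {R : realType} {E : lmodType R} {I : finType}
    {x : I -> E} {S : {set I}} {v : E} :
  convex_hull [set x i | i in [set` S]] v <-> convex_combination x S v.
Proof.
split=> [|xv C [cC xC]]; last first.
  by apply: convex_set_combination xv => // i iS; apply: xC; exists i.
apply: smallest_sub v => [a b t|_ [i iS <-]]; last first.
  exact: convex_combination_point.
rewrite !inE => -[wa wwa ->] [wb wwb ->].
exists (fun i => t%:num * wa i + (1 - t%:num) * wb i).
  exact: convex_weights_mix.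
exact: sum_weights_mix.
Qed.

(** * The hull is spanned by its vertices *)

(** If [x i] lies strictly between [a] and [b] in the hull, mixing their weights
    writes [x i] as a combination in which [x i] itself has some weight [w i].
    When [w i < 1], solving for [x i] expresses it through the other points.
    When [w i = 1], both [a] and [b] put all their weight on [x i], so
    [a = b = x i]. *)
Lemma non_extreme_in_hull {R : realType} {E : lmodType R} {I : finType}
    {x : I -> E} {S : {set I}} {i : I} :
  i \in S -> ~ extreme_point (convex_hull [set x j | j in [set` S]]) (x i) ->
  convex_hull [set x j | j in [set` (S :\ i)%SET]] (x i).
Proof.
move=> iS; apply: contra_notP => xi_out; split.
  exact/convex_hull_imageP/convex_combination_point.
move=> a b t /convex_hull_imageP[wa wwa ->].
move=> /convex_hull_imageP[wb wwb ->] t0 t1 xiE.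
have wai_le1 := convex_weight_le1 iS wwa.
have wbi_le1 := convex_weight_le1 iS wwb.
pose w j := t%:num * wa j + (1 - t%:num) * wb j.
have ww : convex_weights S w by exact: convex_weights_mix.
have xiw : x i = \sum_(j in S) w j *: x j.
  by rewrite {1}xiE; exact: sum_weights_mix.
have [wi1|wi1] := ltP (w i) 1.
  exfalso; apply/xi_out/convex_hull_imageP.
  have [y xy yE] := sum_weights_split x iS ww wi1.
  suff -> : x i = y by [].
  have u_neq0 : 1 - w i != 0 by rewrite subr_eq0 gt_eqF.
  apply: (scalerI u_neq0); apply: (addrI (w i *: x i)).
  by rewrite -yE -xiw -scalerDl subrKC scale1r.
have wai1 : wa i = 1 by move: wi1; rewrite /w; nra.
have wbi1 : wb i = 1 by move: wi1; rewrite /w; nra.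
by split; exact: sum_weight1.
Qed.

(** By induction on the number of scenarios: either all are vertices, or one can
    be deleted while preserving both the hull and its set of vertices. *)
Lemma scenario_hull_vertices {R : realType} {p N : nat}
    (scen : 'I_N -> 'rV[R]_p) (S : {set 'I_N}) :
  scenario_hull scen (vertex_scenarios scen S) = scenario_hull scen S.
Proof.
have [n] := ubnP #|S|; elim: n => // n IHn in S *; rewrite ltnS => Sn.
have [->//|] := eqVneq (vertex_scenarios scen S) S.
have VS : vertex_scenarios scen S \subset S.
  by apply/fintype.subsetP => s /[!inE]/andP[].
rewrite finset.eqEsubset VS/= => /subsetPn[s sS sV].
have s_hull : scenario_hull scen (S :\ s) (scen s).
  apply: non_extreme_in_hull => // sx; move: sV; rewrite inE sS/=.
  by move/negP; apply; exact/asboolP.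
have hullE : scenario_hull scen (S :\ s) = scenario_hull scen S.
  apply/seteqP; split=> v hv C [cC SC]; apply: hv; split=> //.
  - by move=> _ [r /setD1P[_ rS] <-]; apply: SC; exists r.
  - move=> _ [r rS <-]; have [->|rs] := eqVneq r s.
      exact: s_hull.
    by apply: SC; exists r => //; apply/setD1P.
have vertexE : vertex_scenarios scen (S :\ s) = vertex_scenarios scen S.
  apply/setP => r; rewrite [LHS]inE [RHS]inE hullE in_setD1.
  have [->|//] := eqVneq r s.
  by apply/esym/negbTE; move: sV; rewrite inE.
rewrite -vertexE IHn//; apply: leq_trans Sn.
by rewrite [leqRHS](cardsD1 s) sS.
Qed.

Lemma quasiconvex_sublevel {R : realType} {E : lmodType R} {f : E -> R}
    (r : R) :
  quasiconvex f -> @convex_set R E [set v | f v <= r].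
Proof.
move=> qf a b t; rewrite !inE/= => ar br; apply: le_trans (qf a b t) _.
by rewrite ge_max ar.
Qed.

Lemma quasiconvex_hull_scenarios {R : realType} {p N : nat}
    {scen : 'I_N -> 'rV[R]_p} {S : {set 'I_N}} {f : 'rV[R]_p -> R} {r : R} :
  quasiconvex f ->
  (forall t, t \in vertex_scenarios scen S -> f (scen t) <= r) ->
  forall s, s \in hull_scenarios scen S -> f (scen s) <= r.
Proof.
move=> qf fV s; rewrite inE -scenario_hull_vertices => /asboolP.
apply: (@smallest_sub _ _ _ [set v | f v <= r]) => [|_ [t tV <-]].
  exact: quasiconvex_sublevel.
exact: fV.
Qed.

(** * Changing the selected scenarios *)

(** The objective depends on [x] only, so a constraint on [z] is valid as soon
    as every feasible [x] keeps some feasible [z] that meets it. *)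
Lemma miccp_valid_recourse {R : realType} {d p N : nat} {X : set 'rV[R]_d}
    {F : 'rV[R]_d -> R} {c : 'rV[R]_d -> 'rV[R]_p -> R}
    {scen : 'I_N -> 'rV[R]_p} {prob : 'I_N -> R} {tau : R} {M : 'I_N -> R}
    (Q : {ffun 'I_N -> bool} -> Prop) :
  (forall x z, miccp_feasible X c scen prob tau M (x, z) ->
     exists2 z', miccp_feasible X c scen prob tau M (x, z') & Q z') ->
  miccp_valid X F c scen prob tau M Q.
Proof.
move=> QE; apply: ereal_inf_le_tmp => _ [[x z] /QE[z' xz' Qz'] <-].
by exists (x, z').
Qed.

Definition satisfied {R : realType} {d p N : nat}
    (c : 'rV[R]_d -> 'rV[R]_p -> R) (scen : 'I_N -> 'rV[R]_p) (x : 'rV[R]_d)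
    : {ffun 'I_N -> bool} :=
  [ffun s => c x (scen s) <= 0].

Lemma big_M_satisfied {R : realType} {d p N : nat} {X : set 'rV[R]_d}
    {c : 'rV[R]_d -> 'rV[R]_p -> R} {scen : 'I_N -> 'rV[R]_p}
    {M : 'I_N -> R} (hM : forall s x, X x -> c x (scen s) <= M s)
    (x : 'rV[R]_d) (z : {ffun 'I_N -> bool}) :
  X x -> (forall s, z s -> satisfied c scen x s) ->
  forall s, c x (scen s) <= M s * (1 - (z s)%:R).
Proof.
move=> Xx zc s; have := zc s; case: (z s) => [/(_ isT)|_].
  by rewrite ffunE subrr mulr0.
by rewrite subr0 mulr1 hM.
Qed.

(** A selected scenario is satisfied, so passing to all the satisfied scenarios
    can only increase the selected probability. *)
Lemma satisfied_feasible {R : realType} {d p N : nat} {X : set 'rV[R]_d}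
    {c : 'rV[R]_d -> 'rV[R]_p -> R} {scen : 'I_N -> 'rV[R]_p}
    {prob : 'I_N -> R} {tau : R} {M : 'I_N -> R}
    (hM : forall s x, X x -> c x (scen s) <= M s)
    (x : 'rV[R]_d) (z : {ffun 'I_N -> bool}) :
  (forall s, 0 <= prob s) -> miccp_feasible X c scen prob tau M (x, z) ->
  miccp_feasible X c scen prob tau M (x, satisfied c scen x).
Proof.
move=> prob0 [/= Xx hz cz]; split=> //=; last exact: (big_M_satisfied hM).
apply: le_trans hz _; apply: ler_sum => s _; rewrite ler_wpM2l// ler_nat.
case zs : (z s) => //; have := cz s.
by rewrite zs subrr mulr0 ffunE => ->.
Qed.

(** * The valid inequalities *)

Theorem proposition5 (R : realType) (d p N : nat)
  (disp : measure_display) (Omega : measurableType disp)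
  (P : probability Omega R) (xi : Omega -> 'rV[R]_p)
  (hxi : forall j : 'I_p, measurable_fun [set: Omega] (fun w => xi w 0 j))
  (scen : 'I_N -> 'rV[R]_p) (hscen : injective scen)
  (prob : 'I_N -> R)
  (hprob : forall s : 'I_N, P (xi @^-1` [set scen s]) = (prob s)%:E)
  (hsum : \sum_(s < N) prob s = 1)
  (X : set 'rV[R]_d) (F : 'rV[R]_d -> R) (c : 'rV[R]_d -> 'rV[R]_p -> R)
  (tau : R) (htau0 : 0 < tau) (htau1 : tau < 1)
  (M : 'I_N -> R)
  (hM : forall (s : 'I_N) (x : 'rV[R]_d), X x -> c x (scen s) <= M s)
  (hA : forall s : 'I_N,
      0 < prob s /\ (-oo < nu X F c scen [set s]%SET)%E)
  (hB : forall x : 'rV[R]_d, X x -> quasiconvex (c x))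
  (S : {set 'I_N}) :
  miccp_valid X F c scen prob tau M
    (fun z : {ffun 'I_N -> bool} => forall s : 'I_N,
       s \in (hull_scenarios scen S :\: vertex_scenarios scen S)%SET ->
       \sum_(t in vertex_scenarios scen S) (z t)%:R
         - #|vertex_scenarios scen S|%:R + 1 <= (z s)%:R :> R)
  /\
  ((forall s : 'I_N, prob s = N%:R^-1) ->
   (1 - tau) + N%:R^-1 <= \sum_(s in hull_scenarios scen S) prob s ->
   miccp_valid X F c scen prob tau M
     (fun z : {ffun 'I_N -> bool} => \sum_(t in vertex_scenarios scen S) (z t)%:R
                 <= #|vertex_scenarios scen S|%:R - 1 :> R)).
Proof.
set V := vertex_scenarios scen S.
have prob0 s : 0 <= prob s by rewrite ltW//; case: (hA s).
have sum_le (z : {ffun 'I_N -> bool}) t : t \in V -> ~~ z t ->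
    \sum_(r in V) (z r)%:R <= #|V|%:R - 1 :> R.
  move=> tV /negbTE zt; rewrite (big_setD1 t tV)/= zt add0r (cardsD1 t V) tV.
  rewrite natrD addrC addKr -sumr_const.
  by apply: ler_sum => r _; rewrite lern1 leq_b1.
have all_or (z : {ffun 'I_N -> bool}) : {in V, forall t, z t} \/
    \sum_(r in V) (z r)%:R <= #|V|%:R - 1 :> R.
  have [/forall_inP|/forall_inPn[t tV zt]] := boolP [forall t in V, z t].
    by left.
  by right; exact: sum_le zt.
have satisfied_hull x : X x -> {in V, forall t, satisfied c scen x t} ->
    {in hull_scenarios scen S, forall s, satisfied c scen x s}.
  move=> Xx xV s sN; rewrite ffunE.
  apply: (quasiconvex_hull_scenarios (hB x Xx) _ s sN) => t tV.
  by have := xV t tV; rewrite ffunE.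
split.
  apply: miccp_valid_recourse => x z xz; exists (satisfied c scen x).
    exact: (satisfied_feasible hM _ z).
  move=> s /setDP[sN _]; case: (all_or (satisfied c scen x)) => [xV|xV].
    rewrite (satisfied_hull x _ xV s sN); last by case: xz.
    rewrite gerDr subr_le0 -sumr_const.
    by apply: ler_sum => r _; rewrite lern1 leq_b1.
  by apply: le_trans (ler0n _ _); move: xV; lra.
move=> probE hN; apply: miccp_valid_recourse => x z xz; have [Xx _ _] := xz.
case: (all_or (satisfied c scen x)) => [xV|xV]; last first.
  exists (satisfied c scen x) => //; exact: (satisfied_feasible hM _ z).
(* The hull of the empty set is empty, against the probability of N(S). *)
have [V0|[v vV]] := set_0Vmem V.
  have N0 : hull_scenarios scen S = finset.set0.
    apply/setP => s; rewrite !inE -scenario_hull_vertices -/V V0.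
    apply/asboolP => /convex_hull_imageP[w [_ +] _].
    by rewrite big_set0 => /esym/eqP; rewrite oner_eq0.
  have Ninv : 0 <= N%:R^-1 :> R by rewrite invr_ge0.
  by exfalso; move: hN Ninv; rewrite N0 big_set0; lra.
(* All of N(S) is satisfied; any one vertex can be given up. *)
pose z' : {ffun 'I_N -> bool} := [ffun s => (s != v) && satisfied c scen x s].
exists z'; last by apply: (sum_le _ v vV); rewrite ffunE eqxx.
split=> //=; last first.
  by apply: (big_M_satisfied hM) => // s; rewrite ffunE => /andP[].
have vN : v \in hull_scenarios scen S.
  rewrite inE; apply/asboolP/convex_hull_imageP/convex_combination_point.
  by move: vV; rewrite inE => /andP[].
apply: (@le_trans _ _ (\sum_(s in hull_scenarios scen S :\ v) prob s)).
  by move: hN; rewrite (big_setD1 v vN)/= probE; lra.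
rewrite big_mkcond/=; apply: ler_sum => s _.
case: ifP => [/setD1P[sv sN]|_]; last by rewrite mulr_ge0.
by rewrite ffunE sv (satisfied_hull x Xx xV s sN) mulr1.
Qed.
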